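(* Suppose that $\mathcal{E}$ is a commutative associative $F$-algebra with involution $*$, $\mathcal{W}$ is a left $\mathcal{E}$-module, $N:\mathcal{W}\to\mathcal{E}$ is a cubic form over $\mathcal{E}$, and $h:\mathcal{W}\times\mathcal{W}\to\mathcal{E}$ is a nondegenerate hermitian form such that $(h,N)$ has an adjoint. If $(h,N)$ satisfies the adjoint identity, then $\mathcal{A}(h,N)$ is a structurable algebra. If $\mathcal{E}$ contains a skew element that is invertible in $\mathcal{E}$, then the converse holds (that is, if $\mathcal{A}(h,N)$ is structurable then $(h,N)$ satisfies the adjoint identity).
   Context: $F$ is a field of characteristic $\ne 2,3$. ''Algebra'' means unital, not necessarily associative $F$-algebra. An algebra with involution is an algebra with an anti-automorphism $*$ of period 2 (the identity is allowed on commutative algebras); an element $x$ is skew if $x^*=-x$. A structurable algebra is an algebra with involution satisfying $\{xy\{zwq\}\}-\{zw\{xyq\}\}=\{\{xyz\}wq\}-\{z\{yxw\}q\}$, where $\{xyz\}=(xy^* )z+(zy^* )x-(zx^* )y$. A cubic form $N:\mathcal{W}\to\mathcal{E}$ over $\mathcal{E}$ is a map of the form $N(x)=\frac16f(x,x,x)$ with $f:\mathcal{W}^3\to\mathcal{E}$ symmetric and $\mathcal{E}$-trilinear ($f$ is the full linearization of $N$); $\partial_uN|_v=\frac12f(u,v,v)$ (the coefficient of $a$ in $N(v+au)$, $a\in F$). A hermitian form is a biadditive $h:\mathcal{W}\times\mathcal{W}\to\mathcal{E}$ with $h(au,v)=ah(u,v)$, $h(u,av)=a^*h(u,v)$, $h(v,u)=h(u,v)^*$;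 it is nondegenerate if $h(\mathcal{W},u)=0$ implies $u=0$. $(h,N)$ has an adjoint if for each $v\in\mathcal{W}$ there is $v^\natural\in\mathcal{W}$ (necessarily unique) with $\partial_uN|_v=h(u,v^\natural)$ for all $u\in\mathcal{W}$; then $u\diamond v:=(u+v)^\natural-u^\natural-v^\natural$. $(h,N)$ satisfies the adjoint identity if it has an adjoint and $(v^\natural)^\natural=N(v)v$ for all $v\in\mathcal{W}$. When $(h,N)$ has an adjoint, $\mathcal{A}(h,N)=\mathcal{E}\oplus\mathcal{W}$ is the algebra with involution with $(a,v)(b,w)=(ab+h(v,w),\,aw+b^*v+v\diamond w)$ and $(a,v)^*=(a^*,v)$. *)

(* Defs.v *)
From HB Require Import structures.
From mathcomp Require Import all_boot all_algebra sesquilinear.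
From mathcomp Require Import boolp.

Set Implicit Arguments.
Unset Strict Implicit.
Unset Printing Implicit Defensive.

Import GRing.Theory.
Local Open Scope ring_scope.

Section InvolutiveAlgebras.
Variable F : fieldType.

Definition involution_on (A : lmodType F) (mul : A -> A -> A) (star : A -> A) :=
  [/\ linear star,
      forall x y, star (mul x y) = mul (star y) (star x)
    & involutive star].

(* Unital, not necessarily associative F-algebras with involution. *)
Record invAlg := InvAlg {
  ia_sort :> lmodType F;
  ia_mul : ia_sort -> ia_sort -> ia_sort;
  ia_one : ia_sort;
  ia_star : ia_sort -> ia_sort;
  ia_mul_linearl : forall y, linear (ia_mul^~ y);
  ia_mul_linearr : forall x, linear (ia_mul x);
  ia_mul1l : left_id ia_one ia_mul;
  ia_mul1r : right_id ia_one ia_mul;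
  ia_starP : involution_on ia_mul ia_star
}.

Definition triple (A : invAlg) (x y z : A) : A :=
  ia_mul (ia_mul x (ia_star y)) z + ia_mul (ia_mul z (ia_star y)) x
  - ia_mul (ia_mul z (ia_star x)) y.

Definition structurable (A : invAlg) : Prop :=
  forall x y z w q : A,
    triple x y (triple z w q) - triple z w (triple x y q)
    = triple (triple x y z) w q - triple z (triple y x w) q.

End InvolutiveAlgebras.

(* W viewed as an F-module by restriction of scalars along F -> E. *)
Definition scalar_res (F : fieldType) (E : comAlgType F) (W : lmodType E) : Type
  := W.

Section ScalarRes.
Variables (F : fieldType) (E : comAlgType F) (W : lmodType E).

HB.instance Definition _ := GRing.Zmodule.copy (scalar_res W) W.

Definition scalar_res_scale (a : F) (w : scalar_res W) : scalar_res W :=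
  (a%:A : E) *: (w : W).

Fact scalar_res_scalerA a b w :
  scalar_res_scale a (scalar_res_scale b w) = scalar_res_scale (a * b) w.
Proof. by rewrite /scalar_res_scale scalerA -scalerAl mul1r scalerA. Qed.

Fact scalar_res_scale1r : left_id 1 scalar_res_scale.
Proof. by move=> w; rewrite /scalar_res_scale !scale1r. Qed.

Fact scalar_res_scalerDr : right_distributive scalar_res_scale +%R.
Proof. by move=> a u v; rewrite /scalar_res_scale scalerDr. Qed.

Fact scalar_res_scalerDl w : {morph scalar_res_scale^~ w : a b / a + b}.
Proof. by move=> a b; rewrite /scalar_res_scale !scalerDl. Qed.

HB.instance Definition _ :=
  GRing.Zmodule_isLmodule.Build F (scalar_res W)
    scalar_res_scalerA scalar_res_scale1r scalar_res_scalerDr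
    scalar_res_scalerDl.

End ScalarRes.

Section Forms.
Variables (F : fieldType) (E : comAlgType F) (W : lmodType E).

(* A cubic form is carried by its full linearization f, with N(x) = f(x,x,x)/6;
   N determines f when the characteristic is not 2 or 3. *)
Record cubicForm := CubicForm {
  cf_lin : W -> W -> W -> E;
  cf_sym12 : forall u v w, cf_lin u v w = cf_lin v u w;
  cf_sym23 : forall u v w, cf_lin u v w = cf_lin u w v;
  cf_linear1 : forall v w, scalar (fun u => cf_lin u v w);
  cf_linear2 : forall u w, scalar (fun v => cf_lin u v w);
  cf_linear3 : forall u v, scalar (fun w => cf_lin u v w)
}.

Definition cf_eval (N : cubicForm) (x : W) : E := 6%:R^-1 *: cf_lin N x x x.
Coercion cf_eval : cubicForm >-> Funclass.

(* cf_diff N u v is the derivative of N at v in the direction u. *)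
Definition cf_diff (N : cubicForm) (u v : W) : E := 2%:R^-1 *: cf_lin N u v v.

Variable star : E -> E.
(* {hermitian_sym W for star} is biadditive, E-linear on the left and
   star-semilinear on the right, with h u v = (-1) ^+ false * star (h v u). *)
Implicit Types (h : {hermitian_sym W for star}) (N : cubicForm).

Definition nondeg h := forall u : W, (forall w : W, h w u = 0) -> u = 0.

Definition has_adjoint h N :=
  forall v : W, exists v' : W, forall u : W, cf_diff N u v = h u v'.

(* The choice is immaterial when h is nondegenerate: the adjoint is unique. *)
Definition sharp h N (hN : has_adjoint h N) (v : W) : W := sval (cid (hN v)).

Definition adjoint_identity h N :=
  exists hN : has_adjoint h N,
    forall v : W, sharp hN (sharp hN v) = N v *: v.

Definition diamond h N (hN : has_adjoint h N) (u v : W) : W :=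
  sharp hN (u + v) - sharp hN u - sharp hN v.

End Forms.

Section HermitianCubicAlgebra.
Variables (F : fieldType) (char2 : 2%N \notin [pchar F]).
Variables (E : comAlgType F) (star : E -> E).
Hypothesis starP : @involution_on F E *%R star.
Variables (W : lmodType E) (h : {hermitian_sym W for star}) (N : cubicForm W).
Hypotheses (h_nondeg : nondeg h) (hN : has_adjoint h N).

Let A : lmodType F := (E * scalar_res W)%type.

(* diamond is star-semilinear in each argument; this product is F-bilinear
   because star fixes the scalars a%:A, a : F. *)
Definition hca_mul (x y : A) : A :=
  let: (a, v) := x in let: (b, w) := y in
  (a * b + h v w, (a *: (w : W) + star b *: (v : W) + diamond hN v w : W)).

Definition hca_one : A := (1, 0).

Definition hca_star (x : A) : A := let: (a, v) := x in (star a, v).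

Lemma two_neq0 : 2%:R != 0 :> F.
Proof. by move: char2; rewrite inE. Qed.

Lemma sharpP v u : cf_diff N u v = h u (sharp hN v).
Proof. exact: (svalP (cid (hN v))). Qed.

Lemma hermB u v w : h u (v - w) = h u v - h u w.
Proof. exact: linearBr. Qed.

Lemma herm_inj u v : (forall w, h w u = h w v) -> u = v.
Proof.
move=> uv; apply/eqP; rewrite -subr_eq0; apply/eqP/h_nondeg => w.
by rewrite hermB uv subrr.
Qed.

Lemma herm_diamond u v w : h u (diamond hN v w) = cf_lin N u v w.
Proof.
rewrite /diamond !hermB -!sharpP /cf_diff.
have D2 x y z t : cf_lin N x (y + z) t = cf_lin N x y t + cf_lin N x z t.
  by have := cf_linear2 N x t 1 y z; rewrite scale1r mul1r.
have D3 x y z t : cf_lin N x t (y + z) = cf_lin N x t y + cf_lin N x t z.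
  by have := cf_linear3 N x t 1 y z; rewrite scale1r mul1r.
rewrite D2 !D3 -!scalerBr (cf_sym23 N u w v).
set a := cf_lin N u v v; set b := cf_lin N u v w; set c := cf_lin N u w w.
have -> : a + b + (b + c) - a - c = 2%:R *: b.
  by rewrite scaler_nat mulr2n [_ + (b + c) - a]addrAC [a + b - a]addrAC subrr
    add0r addrA addrK.
by rewrite scalerA mulVf ?scale1r ?two_neq0.
Qed.

Lemma diamondC u v : diamond hN u v = diamond hN v u.
Proof. by apply: herm_inj => w; rewrite !herm_diamond cf_sym23. Qed.

Lemma hermP u b v w : h u (b *: v + w) = star b * h u v + h u w.
Proof. exact: linearPr. Qed.

Lemma hermPl b u v w : h (b *: u + v) w = b * h u w + h v w.
Proof. exact: linearPl. Qed.

Lemma hermC' u v : h u v = star (h v u).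
Proof. by rewrite (@hermitian_subproof _ _ _ _ h u v) expr0 mul1r. Qed.

Lemma starL a x y : star (a *: x + y) = a *: star x + star y.
Proof. by case: starP => sl _ _; exact: sl. Qed.

Lemma starK x : star (star x) = x.
Proof. by case: starP. Qed.

Lemma starM x y : star (x * y) = star x * star y.
Proof. by case: starP => _ -> _; rewrite mulrC. Qed.

Lemma star1 : star 1 = 1.
Proof. by have := starM 1 (star 1); rewrite mul1r !starK mulr1. Qed.

Lemma star0 : star 0 = 0.
Proof. by have := starL (-1) 0 0; rewrite scaleN1r oppr0 addr0 scaleN1r addNr. Qed.

Lemma starD x y : star (x + y) = star x + star y.
Proof. by rewrite -[x]scale1r starL !scale1r. Qed.

Lemma star_alg (a : F) : star a%:A = a%:A.
Proof. by rewrite -[X in star X]addr0 starL star0 addr0 star1. Qed.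

Lemma diamondPr (b : E) u v w :
  diamond hN u (b *: v + w) = star b *: diamond hN u v + diamond hN u w.
Proof.
apply: herm_inj => t; rewrite hermP !herm_diamond starK.
exact: cf_linear3.
Qed.

Lemma diamond0r u : diamond hN u 0 = 0.
Proof.
have := diamondPr 1 u 0 0; rewrite scale1r addr0 star1 scale1r => /eqP.
by rewrite -subr_eq0 opprD addrA subrr sub0r oppr_eq0 => /eqP.
Qed.

Lemma hca_scaleE (a : F) (b : E) (w : W) :
  a *: ((b, w) : A) = (a *: b, a%:A *: w).
Proof. by []. Qed.

Fact hca_mul_linearr x : linear (hca_mul x).
Proof.
case: x => a v k [b w] [c t]; rewrite !hca_scaleE.
rewrite /hca_mul /= starL hermP diamondPr star_alg.
congr (_, _).
  by rewrite mulrDr -scalerAr -scalerAl mul1r scalerDr addrACA.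
move: (diamond hN v w) (diamond hN v t) => d e /=.
rewrite !scalerDr !scalerDl !scalerA -!scalerAl -!scalerAr !mul1r mulr1.
by rewrite [RHS]addrACA [X in _ = X + _]addrACA.
Qed.

Fact hca_starP : involution_on hca_mul hca_star.
Proof.
split.
- by move=> k [a v] [b w]; rewrite /hca_star /= starL.
- move=> [a v] [b w]; rewrite /hca_star /hca_mul starD starM !starK.
  by rewrite -hermC' diamondC mulrC [X in (_, X + _)]addrC.
- by move=> [a v]; rewrite /hca_star starK.
Qed.

Fact hca_mul_linearl y : linear (hca_mul^~ y).
Proof.
have [starl starA starI] := hca_starP.
have mulE z : hca_mul z y = hca_star (hca_mul (hca_star y) (hca_star z)).
  by rewrite -starA starI.
by move=> k u v; rewrite !mulE starl hca_mul_linearr starl.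
Qed.

Fact hca_mul1r : right_id hca_one hca_mul.
Proof.
case=> a v; rewrite /hca_mul /= diamond0r addr0 scaler0 add0r mulr1 star1.
by rewrite scale1r hermC' (linear0l h) star0 addr0.
Qed.

Fact hca_mul1l : left_id hca_one hca_mul.
Proof.
case=> a v; rewrite /hca_mul /= diamondC diamond0r addr0 scale1r scaler0 addr0.
by rewrite mul1r (linear0l h) addr0.
Qed.

Definition herm_cubic_alg : invAlg F :=
  InvAlg hca_mul_linearl hca_mul_linearr hca_mul1l hca_mul1r hca_starP.

End HermitianCubicAlgebra.

(* Main.v *)
(** Write V_{x,y} z = {x y z}, let L_u be left multiplication by (0, u), and let
    D_e map (c, w) to ((2 e - star e) c, (star e) w).  Without the adjoint
    identity one has
      V_{(a,u),(b,v)} = D_{a (star b) + h(v,u)} + L_{a v + b u + u<>v}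
                        + [L_u, L_v].
    The algebra is structurable iff every pair (V_{x,y}, V_{y,x}) is a
    derivation of the triple product; such pairs are closed under sums and
    commutators, and (D_e, D_{star e}) always is one.  As L_u = V_{1,u} = V_{u,1}, everything
    reduces to (L_u, L_u), whose failure to be a derivation is
    Q(t;u,x,y) + Q(x;u,y,t) - Q(y;u,x,t) - P(u,x,y,t), where P is the full
    linearization of the adjoint identity and Q its dual under h.  So P = 0
    suffices.  Conversely P is linear and Q semilinear in u, so comparing u with
    s u for an invertible skew s gives 2 s P = 0. *)
Require Import Defs.
From mathcomp Require Import all_boot all_algebra sesquilinear.
From mathcomp Require Import boolp ring.

Set Implicit Arguments.
Unset Strict Implicit.
Unset Printing Implicit Defensive.

Import GRing.Theory.
Local Open Scope ring_scope.

(** * Division by integers and polarization of quartic maps *)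

Lemma natr_inv (F : fieldType) (E : algType F) n :
  n%:R != 0 :> F -> exists c : E, c * n%:R = 1.
Proof.
move=> n0; exists (n%:R^-1)%:A.
by rewrite mulr_algl -scaler_nat scalerA mulVf // scale1r.
Qed.

(** Arguments are separated one pair at a time, from [p v v v v] to [p u u v v], then [p u v w w],
    then [p u v w x]. Additivity alone makes all coefficients integers, namely 12, 2 and 2. *)
Lemma quartic_polarization (F : fieldType) (E : comAlgType F) (V : zmodType)
    (p : V -> V -> V -> V -> E) :
  2%:R != 0 :> F -> 3%:R != 0 :> F ->
  (forall u v w x, p u v w x = p v u w x) ->
  (forall u v w x, p u v w x = p u w v x) ->
  (forall u v w x, p u v w x = p u v x w) ->
  (forall u u' v w x, p (u + u') v w x = p u v w x + p u' v w x) ->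
  (forall v, p v v v v = 0) -> forall u v w x, p u v w x = 0.
Proof.
move=> F2 F3 p12 p23 p34 pD1 p0.
have pN1 u v w x : p (- u) v w x = - p u v w x.
  have p00 : p 0 v w x = 0.
    by apply: (addrI (p 0 v w x)); rewrite -pD1 !addr0.
  by apply/eqP; rewrite -addr_eq0 -pD1 addNr p00.
have pD2 u v v' w x : p u (v + v') w x = p u v w x + p u v' w x.
  by rewrite p12 pD1 !(p12 _ u).
have pD3 u v w w' x : p u v (w + w') x = p u v w x + p u v w' x.
  by rewrite p23 pD2 !(p23 _ _ v).
have pD4 u v w x x' : p u v w (x + x') = p u v w x + p u v w x'.
  by rewrite p34 pD3 !(p34 _ _ _ w).
have pN2 u v w x : p u (- v) w x = - p u v w x by rewrite p12 pN1 p12.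
have pN3 u v w x : p u v (- w) x = - p u v w x by rewrite p23 pN2 p23.
have pN4 u v w x : p u v w (- x) = - p u v w x by rewrite p34 pN3 p34.
have nat_eq0 n (c : E) : n%:R != 0 :> F -> n%:R * c = 0 -> c = 0.
  move=> /(natr_inv E) [i iK] nc0.
  by rewrite -[c]mul1r -iK -mulrA nc0 mulr0.
have p22 u v : p u u v v = 0.
  (* p(u + v) + p(u - v) = 2 p(u) + 2 p(v) + 12 p(u, u, v, v) *)
  apply: (nat_eq0 12); first by rewrite (natrM _ 4 3) (natrM _ 2 2) !mulf_neq0.
  have := p0 (u + v); have := p0 (u - v).
  rewrite !(pD1, pD2, pD3, pD4, pN1, pN2, pN3, pN4).
  rewrite !(p12 v u, p23 _ v u, p34 _ _ v u) !p0 => pm pp.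
  rewrite -[RHS](addr0 0) -[X in _ = X + _]pm -[X in _ = _ + X]pp; ring.
have p211 u v w : p u v w w = 0.
  apply: (nat_eq0 2) => //.
  have := p22 (u + v) w; rewrite !(pD1, pD2) !p22 (p12 v u) => pp.
  rewrite -[RHS]pp; ring.
move=> u v w x; apply: (nat_eq0 2) => //.
have := p211 u v (w + x); rewrite !(pD3, pD4) !p211 (p34 _ _ x w) => pp.
rewrite -[RHS]pp; ring.
Qed.

Lemma zmod_morphismD (U V : zmodType) (g : U -> V) :
  zmod_morphism g -> {morph g : x y / x + y}.
Proof.
move=> gB x y; have g0 : g 0 = 0 by rewrite -(subrr 0) gB subrr.
by rewrite -[y in LHS]opprK gB -[- y]sub0r gB g0 sub0r opprK.
Qed.

(** * Derivation pairs of the triple product *)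

Section TripleDerivations.
Variables (F : fieldType) (A : invAlg F).
Implicit Types (D G : A -> A) (x y z w q : A).

Lemma ia_mulDl x y z : ia_mul (x + y) z = ia_mul x z + ia_mul y z.
Proof. by have := ia_mul_linearl z 1 x y; rewrite !scale1r. Qed.

Lemma ia_mulDr x y z : ia_mul x (y + z) = ia_mul x y + ia_mul x z.
Proof. by have := ia_mul_linearr x 1 y z; rewrite !scale1r. Qed.

Lemma ia_starD x y : ia_star (x + y) = ia_star x + ia_star y.
Proof. by have [sl _ _] := ia_starP A; have := sl 1 x y; rewrite !scale1r. Qed.

Lemma triple_additivel w q : zmod_morphism (fun z : A => triple z w q).
Proof.
suff tD x y : triple (x + y) w q = triple x w q + triple y w q.
  by move=> x y; have := tD (x - y) y; rewrite subrK => ->; rewrite addrK.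
rewrite /triple ia_starD !(ia_mulDl, ia_mulDr) opprD.
by rewrite [RHS]addrACA; congr (_ + _); exact: addrACA.
Qed.

Lemma triple_additivem z q : zmod_morphism (fun w : A => triple z w q).
Proof.
suff tD x y : triple z (x + y) q = triple z x q + triple z y q.
  by move=> x y; have := tD (x - y) y; rewrite subrK => ->; rewrite addrK.
rewrite /triple ia_starD !(ia_mulDl, ia_mulDr) opprD.
by rewrite [RHS]addrACA; congr (_ + _); exact: addrACA.
Qed.

Lemma triple_additiver z w : zmod_morphism (triple z w : A -> A).
Proof.
suff tD x y : triple z w (x + y) = triple z w x + triple z w y.
  by move=> x y; have := tD (x - y) y; rewrite subrK => ->; rewrite addrK.
rewrite /triple !(ia_mulDl, ia_mulDr) opprD.
by rewrite [RHS]addrACA; congr (_ + _); exact: addrACA.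
Qed.

(* With this sign convention the structurable identity says that
   (V_{x,y}, V_{y,x}), where V_{x,y} z = {x y z}, is always such a pair. *)
Definition triple_derivation D D' := forall z w q : A,
  D (triple z w q) = triple (D z) w q - triple z (D' w) q + triple z w (D q).

Lemma structurable_derivation :
  structurable A <->
  forall x y, triple_derivation (triple x y) (triple y x).
Proof.
split=> AP x y z w q; first by rewrite -AP subrK.
by rewrite AP addrK.
Qed.

Lemma triple_derivationD D D' G G' :
  triple_derivation D D' -> triple_derivation G G' ->
  triple_derivation (fun z => D z + G z) (fun z => D' z + G' z).
Proof.
move=> dD dG z w q; rewrite dD dG.
rewrite (zmod_morphismD (triple_additivel w q)).
rewrite (zmod_morphismD (triple_additivem z q)).
rewrite (zmod_morphismD (triple_additiver z w)).
rewrite (opprD (triple z _ q)) [LHS]addrACA; congr (_ + _); exact: addrACA.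
Qed.

(** The second components compose in the opposite order because they enter the derivation rule with
    a minus sign. *)
Lemma triple_derivation_comm D D' G G' :
  zmod_morphism D -> zmod_morphism G ->
  triple_derivation D D' -> triple_derivation G G' ->
  triple_derivation (fun z => D (G z) - G (D z))
    (fun z => G' (D' z) - D' (G' z)).
Proof.
(* These are the terms of [H (K (triple z w q))] in which the two pairs act on different arguments.
   They are symmetric in the pairs, so they cancel in the commutator. *)
pose cross H H' K K' z w q := triple (H z) w (K q) + triple (K z) w (H q)
  - (triple (H z) (K' w) q + triple (K z) (H' w) q)
  - (triple z (H' w) (K q) + triple z (K' w) (H q)).
have crossC H H' K K' z w q : cross H H' K K' z w q = cross K K' H H' z w q.
  by rewrite /cross; congr (_ - _ - _); exact: addrC.
have comp H H' K K' z w q : zmod_morphism H ->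
    triple_derivation H H' -> triple_derivation K K' ->
  H (K (triple z w q)) = triple (H (K z)) w q + triple z (H' (K' w)) q
    + triple z w (H (K q)) + cross H H' K K' z w q.
  move=> HB dH dK; rewrite dK (zmod_morphismD HB) HB !dH /cross.
  (* opprD would otherwise unfold triple and split its last summand off. *)
  do 9?[move: (triple _ _ _) => ?].
  rewrite !opprD !opprK !addrA.
  by rewrite [LHS](ACl (1*5*9*7*3*4*2*8*6)).
move=> DB GB dD dG z w q.
rewrite (comp D D' G G') // (comp G G' D D') // (crossC G).
rewrite opprD addrACA subrr addr0.
rewrite (triple_additivel w q) (triple_additivem z q) (triple_additiver z w).
do 6?[move: (triple _ _ _) => ?].
rewrite opprB !opprD addrACA; congr (_ + _); exact: addrACA.
Qed.

End TripleDerivations.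

(** * Calculus with [h], [f] and the diamond product in the hermitian cubic algebra *)

Section HermitianCubicAlgebraTheory.
Variables (F : fieldType) (char2 : 2%N \notin [pchar F]).
Variables (E : comAlgType F) (star : E -> E).
Hypothesis starP : @involution_on F E *%R star.
Variables (W : lmodType E) (h : {hermitian_sym W for star}) (N : cubicForm W).
Hypotheses (h_nondeg : nondeg h) (hN : has_adjoint h N).

Local Notation A := (herm_cubic_alg char2 starP h_nondeg hN).
Local Notation f := (cf_lin N).
(* Locked because the additivity rules would otherwise unify with the sum
   that diamond unfolds to. *)
Local Notation "u <*> v" := (locked (diamond hN) u v) (at level 40).
Implicit Types (a b c e : E) (s t u v w x y : W).

Let starK' a : star (star a) = a := starK starP a.
Let starD' a b : star (a + b) = star a + star b := starD starP a b.
Let starM' a b : star (a * b) = star a * star b := starM starP a b.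
Let starN' a : star (- a) = - star a.
Proof. by apply/eqP; rewrite -addr_eq0 -starD' addNr (star0 starP). Qed.

Let star2 : star 2%:R = 2%:R.
Proof. by rewrite [2%:R]/(1 + 1) starD' (star1 starP). Qed.

Let hD u v w : h u (v + w) = h u v + h u w := linearDr _ _ _ _.
Let hDl u v w : h (u + v) w = h u w + h v w := linearDl _ _ _ _.
Let hO u v : h u (- v) = - h u v := linearNr _ _ _.
Let hOl u v : h (- u) v = - h u v := linearNl _ _ _.
Let hZ u a v : h u (a *: v) = star a * h u v := linearZr_LR _ _ _ _.
Let hZl u a v : h (a *: u) v = a * h u v := linearZl_LR _ _ _ _.
Let h0 u : h u 0 = 0 := linear0r _ _.
Let h0l u : h 0 u = 0 := linear0l _ _.
Let hd u v w : h u (v <*> w) = f u v w.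
Proof. by rewrite -lock (herm_diamond char2). Qed.
Let hdl u v w : h (v <*> w) u = star (f u v w).
Proof. by rewrite hermC' hd. Qed.

Let dC u v : u <*> v = v <*> u.
Proof. by rewrite -lock (diamondC char2 h_nondeg). Qed.
Let dD u v w : u <*> (v + w) = u <*> v + u <*> w.
Proof.
have := diamondPr char2 starP h_nondeg hN 1 u v w.
by rewrite (star1 starP) !scale1r -lock.
Qed.
Let d0 u : u <*> 0 = 0.
Proof. by rewrite -lock (diamond0r char2 starP h_nondeg). Qed.
Let d0l u : 0 <*> u = 0.
Proof. by rewrite dC d0. Qed.
Let dZ u a v : u <*> (a *: v) = star a *: (u <*> v).
Proof.
have := diamondPr char2 starP h_nondeg hN a u v 0.
by rewrite (diamond0r char2 starP h_nondeg) !addr0 -lock.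
Qed.
Let dN u v : u <*> (- v) = - (u <*> v).
Proof. by rewrite -scaleN1r dZ starN' (star1 starP) scaleN1r. Qed.
Let dDl u v w : (v + w) <*> u = v <*> u + w <*> u.
Proof. by rewrite dC dD !(dC u). Qed.
Let dZl u a v : (a *: v) <*> u = star a *: (v <*> u).
Proof. by rewrite dC dZ (dC u). Qed.
Let dNl u v : (- v) <*> u = - (v <*> u).
Proof. by rewrite dC dN (dC u). Qed.

Let dE := (dD, dDl, dN, dNl, dZ, dZl).
Let hE := (hD, hDl, hO, hOl, hZ, hZl).
Let starE := (starK', starD', starM', starN', star2).

Definition elt a v : A := (a, v).

Lemma eltP (z : A) : exists a v, z = elt a v.
Proof. by case: z => a v; exists a, v. Qed.

Lemma eltD a u b v : elt a u + elt b v = elt (a + b) (u + v).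
Proof. by []. Qed.

Lemma eltN a u : - elt a u = elt (- a) (- u).
Proof. by []. Qed.

Lemma elt_mul a u b v :
  ia_mul (elt a u) (elt b v) =
  elt (a * b + h u v) (a *: v + star b *: u + u <*> v).
Proof. by rewrite -lock. Qed.

Lemma elt_star a u : ia_star (elt a u) = elt (star a) u.
Proof. by []. Qed.

Let f12 u v w : f u v w = f v u w := cf_sym12 N u v w.
Let f23 u v w : f u v w = f u w v := cf_sym23 N u v w.

Let f0 v w : f 0 v w = 0.
Proof.
by have := cf_linear1 N v w (-1) 0 0; rewrite scaler0 addr0 mulN1r addNr.
Qed.
Let fZ1 a u v w : f (a *: u) v w = a * f u v w.
Proof.
by have := cf_linear1 N v w a u 0; rewrite f0 !addr0.
Qed.
Let fZ2 a u v w : f u (a *: v) w = a * f u v w.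
Proof. by rewrite f12 fZ1 f12. Qed.
Let fZ3 a u v w : f u v (a *: w) = a * f u v w.
Proof. by rewrite f23 fZ2 f23. Qed.
Let fD1 u u' v w : f (u + u') v w = f u v w + f u' v w.
Proof. by have := cf_linear1 N v w 1 u u'; rewrite scale1r mul1r. Qed.
Let fD2 u v v' w : f u (v + v') w = f u v w + f u v' w.
Proof. by rewrite f12 fD1 !(f12 u). Qed.
Let fD3 u v w w' : f u v (w + w') = f u v w + f u v w'.
Proof. by rewrite f23 fD2 !(f23 u v). Qed.
Let fE := (fD1, fD2, fD3, fZ1, fZ2, fZ3).
(** Both sides equal [h (w <*> x) (u <*> v)]. *)
Let star_fd u v w x : star (f (u <*> v) w x) = f u v (w <*> x).
Proof. by rewrite -hdl hd f12 f23. Qed.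

Lemma triple_elt a u b v c w :
  triple (elt a u) (elt b v) (elt c w) =
  elt ((2%:R * (a * star b) - star a * b) * c + c * h v u + a * h v w
       + b * h u w + star (f u v w))
      ((star a * b + h u v) *: w + h w v *: u - h w u *: v
       + star c *: (a *: v + b *: u + u <*> v) + star a *: (v <*> w)
       + star b *: (u <*> w) + (u <*> v) <*> w + u <*> (v <*> w)
       - v <*> (u <*> w)).
Proof.
rewrite /triple !elt_star !elt_mul !eltN !eltD; congr elt.
  rewrite !hE !hdl !starE (f12 w u) (f23 u w) (f23 v w) (f12 v).
  ring.
(* Pairing with an arbitrary [s] turns an equation in [W] into one in the commutative ring [E],
   where [ring] applies. *)
apply: (herm_inj h_nondeg) => s.
rewrite !dE !hE !starE !(dC _ w) !(dC _ v) !(dC _ u) -!(hermC' h).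
ring.
Qed.

(** * Multiplication operators and their failure to be derivations *)

Definition diag e (z : A) : A :=
  elt ((2%:R * e - star e) * z.1) (star e *: (z.2 : W)).

Lemma diag_elt e c w :
  diag e (elt c w) = elt ((2%:R * e - star e) * c) (star e *: w).
Proof. by []. Qed.

Definition lmul u (z : A) : A := ia_mul (elt 0 u) z.

Lemma lmul_elt u c w : lmul u (elt c w) = elt (h u w) (star c *: u + u <*> w).
Proof. by rewrite /lmul elt_mul mul0r add0r scale0r add0r. Qed.

Lemma lmul_additive u : zmod_morphism (lmul u).
Proof.
move=> x y; have := ia_mul_linearr (elt 0 u) (-1) y x.
by rewrite !scaleN1r [X in ia_mul _ X]addrC [RHS]addrC.
Qed.

Lemma triple_operatorE a u b v (z : A) :
  triple (elt a u) (elt b v) z = diag (a * star b + h v u) z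
    + lmul (a *: v + b *: u + u <*> v) z
    + (lmul u (lmul v z) - lmul v (lmul u z)).
Proof.
have [c [w ->]] := eltP z.
rewrite triple_elt diag_elt !lmul_elt eltN !eltD; congr elt.
  rewrite !hE !hd !hdl !starE -!(hermC' h) (f12 w u) (f12 v u) (f23 u w).
  ring.
apply: (herm_inj h_nondeg) => s.
rewrite !dE !hE !starE !(dC _ w) !(dC _ v) !(dC _ u) -!(hermC' h).
ring.
Qed.

(** By [triple_elt], [diag e] is [triple (elt e 0) (elt 1 0)] and [diag (star e)] is
    [triple (elt 1 0) (elt e 0)]. The rule follows from the linearity of [f] and the semilinearity
    of [h] and of the diamond product. *)
Lemma diag_derivation e : triple_derivation (diag e) (diag (star e)).
Proof.
move=> z w q; have [a [x ->]] := eltP z; have [b [y ->]] := eltP w.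
have [c [t ->]] := eltP q.
rewrite triple_elt !diag_elt !triple_elt eltN !eltD; congr elt.
  rewrite !(starE, hE) !(fE, starE) ?starE; ring.
apply: (herm_inj h_nondeg) => s.
rewrite !(starE, dE) !(hE, starE).
ring.
Qed.

(* Its vanishing is the full linearization of (v^#)^# = N(v) v. *)
Definition quartic_defect u v w x :=
  (u <*> v) <*> (w <*> x) + (u <*> w) <*> (v <*> x) + (u <*> x) <*> (v <*> w)
  - f u v w *: x - f u v x *: w - f u w x *: v - f v w x *: u.

(* The dual of quartic_defect under h: linear in y and star-semilinear in v, w,
   x, whereas quartic_defect is linear in all its arguments. *)
Definition quintic_defect y v w x :=
  v <*> (y <*> (w <*> x)) + w <*> (y <*> (v <*> x)) + x <*> (y <*> (v <*> w))
  - h y x *: (v <*> w) - h y w *: (v <*> x) - h y v *: (w <*> x)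
  - star (f v w x) *: y.

(** By [hd] and [star_fd], [h y ((u <*> v) <*> (w <*> x))] is the [star] of
    [h u (v <*> (y <*> (w <*> x)))]; the other products move in the same way. *)
Lemma herm_quartic_defect u v w x y :
  h y (quartic_defect u v w x) = star (h u (quintic_defect y v w x)).
Proof.
rewrite /quartic_defect /quintic_defect !hE !starE -!(hermC' h).
rewrite !hd !hdl -(star_fd u v) -(star_fd u w) -(star_fd u x) !starE.
rewrite !(f12 (u <*> _)).
ring.
Qed.

(** In each product [u] lies under two diamonds, so [star] is applied to [a] twice. *)
Lemma quartic_defectZ a u v w x :
  quartic_defect (a *: u) v w x = a *: quartic_defect u v w x.
Proof.
apply: (herm_inj h_nondeg) => s.
by rewrite /quartic_defect !(dE, starE) !(fE, hE, starE); ring.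
Qed.

(** Here [v] lies under one or three diamonds, or inside a single [h y v] or [star (f v w x)], so
    one [star] survives. *)
Lemma quintic_defectZ a y v w x :
  quintic_defect y (a *: v) w x = star a *: quintic_defect y v w x.
Proof.
apply: (herm_inj h_nondeg) => s.
by rewrite /quintic_defect !(dE, starE) !(fE, hE, starE); ring.
Qed.

Lemma lmul_defect u a x b y c t :
  lmul u (triple (elt a x) (elt b y) (elt c t))
  = triple (lmul u (elt a x)) (elt b y) (elt c t)
    - triple (elt a x) (lmul u (elt b y)) (elt c t)
    + triple (elt a x) (elt b y) (lmul u (elt c t))
    + elt 0 (quintic_defect t u x y + quintic_defect x u y t
             - quintic_defect y u x t - quartic_defect u x y t).
Proof.
rewrite triple_elt !lmul_elt !triple_elt eltN !eltD; congr elt.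
  rewrite !(hE, starE) -!(hermC' h) !hd !hdl !fE !starE addr0.
  rewrite (f23 x y (u <*> t)) !(f12 x (u <*> _)) !star_fd.
  rewrite (f23 u (x <*> y) t) (f23 x y u).
  rewrite !(f12 t) !(f12 y) !(f12 x).
  rewrite (f23 u t x) (f23 u t y) (f23 u y x).
  ring.
apply: (herm_inj h_nondeg) => s.
rewrite /quartic_defect /quintic_defect.
rewrite !(starE, dE) !(hE, starE) -!(hermC' h).
rewrite !(dC _ t) !(dC _ y) !(dC _ x) !(dC _ u).
rewrite !hd !hdl ?starE.
rewrite !(f12 t) !(f12 y) !(f12 x).
rewrite (f23 u t x) (f23 u t y) (f23 u y x).
rewrite (f23 s (x <*> y) (u <*> t)).
ring.
Qed.

Lemma quintic_defect0 y v w x :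
  (forall u v w x, quartic_defect u v w x = 0) -> quintic_defect y v w x = 0.
Proof.
move=> P0; apply: (herm_inj h_nondeg) => u.
by rewrite -[LHS]starK' -herm_quartic_defect P0 !h0 (star0 starP).
Qed.

Lemma lmul_derivation u :
  (forall u v w x, quartic_defect u v w x = 0) ->
  triple_derivation (lmul u) (lmul u).
Proof.
move=> P0 z w q; have [a [x ->]] := eltP z; have [b [y ->]] := eltP w.
have [c [t ->]] := eltP q.
rewrite lmul_defect P0 !quintic_defect0 // addr0 !subr0.
exact: addr0.
Qed.

(** * Structurability in terms of the quartic defect *)

Lemma quartic_defect0_structurable :
  (forall u v w x, quartic_defect u v w x = 0) -> structurable A.
Proof.
move=> P0; apply/structurable_derivation => x y.
have [a [u ->]] := eltP x; have [b [v ->]] := eltP y.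
have -> := funext (triple_operatorE a u b v).
have -> := funext (triple_operatorE b v a u).
(* Swapping the two elements applies [star] to the parameter of [diag], fixes the [lmul] term and
   reverses the commutator, as the second component of a derivation pair requires. *)
have -> : b * star a + h u v = star (a * star b + h v u).
  by rewrite !starE -hermC' mulrC.
have -> : b *: u + a *: v + v <*> u = a *: v + b *: u + u <*> v.
  by rewrite dC (addrC (b *: u)).
apply: triple_derivationD; last first.
  apply: triple_derivation_comm; try exact: lmul_additive.
    exact: lmul_derivation.
  exact: lmul_derivation.
apply: triple_derivationD; first exact: diag_derivation.
exact: lmul_derivation.
Qed.

Lemma triple1_lmul u (z : A) : triple (elt 1 0) (elt 0 u) z = lmul u z.
Proof.
have [c [w ->]] := eltP z; rewrite triple_elt lmul_elt.
rewrite (star0 starP) (star1 starP) !h0 !h0l !f0 (star0 starP) !(d0, d0l).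
congr elt; first by ring.
by rewrite !scaler0 !scale0r !scale1r !(addr0, add0r, subr0, mulr0, scale0r).
Qed.

Lemma triple_lmul1 u (z : A) : triple (elt 0 u) (elt 1 0) z = lmul u z.
Proof.
have [c [w ->]] := eltP z; rewrite triple_elt lmul_elt.
rewrite (star0 starP) (star1 starP) !h0 !h0l f12 !f0 (star0 starP) !(d0, d0l).
congr elt; first by ring.
by rewrite !scaler0 !scale0r !scale1r !(addr0, add0r, subr0, mul0r, scale0r).
Qed.

Lemma structurable_defect u x y t : structurable A ->
  quartic_defect u x y t = quintic_defect t u x y + quintic_defect x u y t
    - quintic_defect y u x t.
Proof.
move=> /structurable_derivation /(_ (elt 1 0) (elt 0 u)).
rewrite (funext (triple1_lmul u)) (funext (triple_lmul1 u)) => dL.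
(* The error term does not involve the [E] components, so they may be taken to be 0. *)
have := lmul_defect u 0 x 0 y 0 t.
rewrite -dL -[X in X = _]addr0 => /addrI /(congr1 snd) /esym /eqP.
by rewrite /= subr_eq0 => /eqP ->.
Qed.

Lemma structurable_quartic_defect0 e e' u v w x :
  star e = - e -> e * e' = 1 -> structurable A -> quartic_defect u v w x = 0.
Proof.
move=> eN ee' AP; have := structurable_defect (e *: u) v w x AP.
rewrite quartic_defectZ !quintic_defectZ eN -scalerDr -scalerBr.
rewrite -structurable_defect // scaleNr => /eqP.
rewrite -addr_eq0 -mulr2n -scaler_nat scalerA => /eqP eP0.
have [i2 i2K] := natr_inv E (two_neq0 char2).
have {i2K} i2e : i2 * e' * (2%:R * e) = 1.
  by rewrite mulrACA i2K (mulrC e') ee' mulr1.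
by rewrite -[LHS]scale1r -i2e -scalerA eP0 scaler0.
Qed.

(** * The quartic defect and the adjoint identity *)

Lemma sharp_double v : v <*> v = 2%:R *: sharp hN v.
Proof.
apply: (herm_inj h_nondeg) => s.
rewrite hZ hd star2 -sharpP /cf_diff -scalerAr mulr_natl -scaler_nat.
by rewrite scalerA mulVf ?scale1r ?(two_neq0 char2).
Qed.

(** As [v <*> v] is twice the adjoint of [v], each of the three products is 8 times the double
    adjoint; each of the four cubic terms is [6 N(v) v]. Both totals are 24. *)
Lemma quartic_defect_diag v : 6%:R != 0 :> F ->
  quartic_defect v v v v = 24%:R *: (sharp hN (sharp hN v) - N v *: v).
Proof.
move=> F6; have fN : f v v v = 6%:R * N v.
  rewrite /cf_eval -scalerAr mulr_natl -scaler_nat.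
  by rewrite scalerA mulVf ?scale1r.
rewrite /quartic_defect (sharp_double v) !dE !starE sharp_double fN.
apply: (herm_inj h_nondeg) => s.
rewrite !hE !starE.
ring.
Qed.

Lemma quartic_defect0P : 3%:R != 0 :> F ->
  (forall u v w x, quartic_defect u v w x = 0) <-> adjoint_identity h N.
Proof.
move=> F3; have F2 := two_neq0 char2.
have F6 : 6%:R != 0 :> F by rewrite (natrM _ 2 3) mulf_neq0.
split=> [P0|[hN' adj] u v w x].
  exists hN => v; apply/eqP; rewrite -subr_eq0; apply/eqP.
  have [|c cK] := @natr_inv F E 24.
    by rewrite (natrM _ 4 6) (natrM _ 2 2) !mulf_neq0.
  rewrite -[LHS]scale1r -cK -scalerA -quartic_defect_diag // P0.
  exact: scaler0.
(* [sharp] depends on the proof of existence of adjoints, and [adjoint_identity] supplies its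
   own. *)
rewrite (Prop_irrelevance hN' hN) in adj.
apply: (herm_inj h_nondeg) => s; rewrite h0.
move: u v w x; apply: quartic_polarization => //.
- move=> u v w x; rewrite /quartic_defect (dC v u) (dC (v <*> w)).
  rewrite (dC (v <*> x)) !(f12 v u) !hE.
  ring.
- move=> u v w x; rewrite /quartic_defect (dC w v) !(f23 u w v) (f12 w v) !hE.
  ring.
- move=> u v w x; rewrite /quartic_defect (dC x w) (f23 u x w) (f23 v x w) !hE.
  ring.
- by move=> u u' v w x; rewrite /quartic_defect !dE !fE !hE !starE; ring.
move=> v; rewrite quartic_defect_diag // -[in sharp hN _ - _]adj subrr.
by rewrite scaler0 h0.
Qed.

End HermitianCubicAlgebraTheory.

Theorem theorem7p2 (F : fieldType)
    (char2 : 2%N \notin [pchar F]) (char3 : 3%N \notin [pchar F])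
    (E : comAlgType F) (star : E -> E)
    (starP : @involution_on F E *%R star)
    (W : lmodType E) (N : cubicForm W) (h : {hermitian_sym W for star})
    (h_nondeg : nondeg h) (hN : has_adjoint h N) :
  (adjoint_identity h N ->
     structurable (herm_cubic_alg char2 starP h_nondeg hN)) /\
  ((exists2 s : E, star s = - s & exists t : E, s * t = 1) ->
     structurable (herm_cubic_alg char2 starP h_nondeg hN) ->
     adjoint_identity h N).
Proof.
have F3 : 3%:R != 0 :> F by move: char3; rewrite inE.
have adjP := quartic_defect0P char2 starP h_nondeg hN F3.
split=> [/adjP|[s sN [t st]] AP]; first exact: quartic_defect0_structurable.
by apply/adjP => u v w x; apply: structurable_quartic_defect0 sN st AP.
Qed.
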